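(* Let $n\ge 3$ and let $W_n$ be the wheel graph obtained from the cycle $C_n$ of order $n$ by adding a new vertex and joining it to all vertices of $C_n$. Then $$\mathrm{gp}(W_n)=\begin{cases}4, & \text{if } n=3,\\ 3, & \text{if } n=4,5,\\ \left\lfloor \frac{2}{3}n\right\rfloor, & \text{if } n\ge 6.\end{cases}$$
   Context: For a connected graph $G$, $d_G(u,v)$ is the number of edges of a shortest $(u,v)$-path, and a $(u,v)$-path of length $d_G(u,v)$ is a $u,v$-geodesic. A set $R\subseteq V(G)$ is a general position set if no three (distinct) vertices of $R$ lie on a common geodesic. The largest cardinality of a general position set is $\mathrm{gp}(G)$. *)

(* Defs.v *)
From mathcomp Require Import all_boot.

Set Implicit Arguments.
Unset Strict Implicit.
Unset Printing Implicit Defensive.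

(* A finite simple graph is a symmetric irreflexive relation on a finType. *)

Section GeneralPosition.

Variables (T : finType) (e : rel T).

(* As in path.v, a path is given by its first vertex u and the sequence p of
   the following ones, so that its number of edges is size p. *)
Definition uv_path (u v : T) (p : seq T) : bool :=
  [&& path e u p, uniq (u :: p) & last u p == v].

(* A path has fewer than #|T| edges; gdist u v is #|T| if u and v are not
   connected. *)
Definition gdist (u v : T) : nat :=
  find (fun k => [exists p : k.-tuple T, uv_path u v p]) (iota 0 #|T|).

Definition geodesic (u v : T) (p : seq T) : bool :=
  uv_path u v p && (size p == gdist u v).

(* Ranging over tuples of size gdist u v loses no geodesic and makes the
   predicate boolean. *)
Definition on_common_geodesic (x y z : T) : bool :=
  [exists u : T, exists v : T, exists p : (gdist u v).-tuple T,
    geodesic u v p && [&& x \in u :: p, y \in u :: p & z \in u :: p]].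

Definition general_position (R : {set T}) : bool :=
  [forall x in R, forall y in R, forall z in R,
    uniq [:: x; y; z] ==> ~~ on_common_geodesic x y z].

Definition gp : nat := \max_(R : {set T} | general_position R) #|R|.

End GeneralPosition.

Definition cycle_graph (n : nat) : rel 'I_n :=
  fun i j => (j == ordS i) || (i == ordS j).
Arguments cycle_graph : clear implicits.

(* Adds a new vertex None adjacent to all vertices of the given graph. *)
Definition cone (T : Type) (e : rel T) : rel (option T) :=
  fun x y => match x, y with
             | Some i, Some j => e i j
             | None, None => false
             | _, _ => true
             end.

Definition wheel (n : nat) : rel (option 'I_n) := cone (cycle_graph n).
Arguments wheel : clear implicits.

Lemma wheel_sym n : symmetric (wheel n).
Proof. by move=> [i|] [j|] //=; rewrite /wheel /= /cycle_graph orbC. Qed.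

Lemma wheel_irrefl n : 1 < n -> irreflexive (wheel n).
Proof.
move=> n_gt1 [i|] //=; rewrite /wheel /= /cycle_graph orbb -val_eqE /=.
have [lt_in|] := ltnP i.+1 n; first by rewrite modn_small // ltn_eqF.
move=> le_ni; have En : n = i.+1 by apply/eqP; rewrite eqn_leq le_ni ltn_ord.
by rewrite -En modnn; apply/negbTE; rewrite -lt0n -ltnS -En.
Qed.

Lemma wheel_connected n (x y : option 'I_n) : connect (wheel n) x y.
Proof.
have cN z : connect (wheel n) z None by case: z => [i|] //; apply: connect1.
apply: connect_trans (cN x) _.
by case: y => [i|] //; apply: connect1.
Qed.

(* Main.v *)
Require Import Defs.
From mathcomp Require Import all_boot zify.

Set Implicit Arguments.
Unset Strict Implicit.
Unset Printing Implicit Defensive.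

(** Any two vertices of a wheel are at distance at most 2, because the hub is
    adjacent to every other vertex.  In a graph of diameter at most 2, three
    distinct vertices lie on a common geodesic exactly when they induce a path
    on three vertices, so the general position sets are the sets of vertices
    on which adjacency is transitive between distinct vertices, that is, the
    disjoint unions of cliques without edges between them
    ([general_positionP]).

    The wheel over the triangle is complete, so all its 4 vertices qualify.
    Let n >= 4.  A qualifying set containing the hub meets the rim in a clique
    of the cycle, hence has at most 3 elements ([card_cycle_clique]), and the
    hub with two consecutive rim vertices attains 3.  A qualifying set of rim
    vertices is one without three consecutive vertices of the cycle: each of
    the n windows of three consecutive vertices contains at most 2 of its
    elements and each element lies in 3 windows, so that it has at most
    2n/3 elements ([card_no_three_consecutive]).  The rim vertices whose
    index is not a multiple of 3 attain the integer part of this bound: the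
    vertex 0 is left out, so three consecutive vertices of this set would have
    three consecutive integers as indices.  The value is therefore the maximum
    of 3 and the integer part of 2n/3; the former is the larger for n = 4, both
    are equal for n = 5, and the latter is the larger for n >= 6. *)

(** * Distances and geodesics *)

Section Geodesics.

Variables (T : finType) (e : rel T).

Lemma size_uv_path_lt u v p : uv_path e u v p -> size p < #|T|.
Proof.
case/and3P=> _ /card_uniqP card_p _.
by rewrite -[(size p).+1]/(size (u :: p)) -card_p max_card.
Qed.

Lemma gdist_le u v p : uv_path e u v p -> gdist e u v <= size p.
Proof.
move=> uvp; have lt_pT := size_uv_path_lt uvp.
rewrite leqNgt; apply/negP => lt_pd.
have /existsP[] := negbT (before_find 0 lt_pd).
by rewrite nth_iota // add0n; exists (in_tuple p).
Qed.

Lemma geodesic_exists u v p : uv_path e u v p -> exists q, geodesic e u v q.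
Proof.
move=> uvp; have lt_dT := leq_ltn_trans (gdist_le uvp) (size_uv_path_lt uvp).
have := lt_dT; rewrite -[X in _ < X](size_iota 0) -has_find => /(nth_find 0).
rewrite nth_iota // add0n => /existsP[q uvq].
by exists q; rewrite /geodesic uvq size_tuple /=.
Qed.

Lemma uv_path2 x y z :
  irreflexive e -> e x y -> e y z -> x != z -> uv_path e x z [:: y; z].
Proof.
move=> irr_e exy eyz neq_xz.
rewrite /uv_path /= exy eyz !inE (negPf neq_xz) orbF eqxx !andbT /=.
apply/andP; split; first by apply: contraTneq exy => ->; rewrite irr_e.
by apply: contraTneq eyz => ->; rewrite irr_e.
Qed.

Lemma gdist_induced_path3 x y z :
  irreflexive e -> e x y -> e y z -> x != z -> ~~ e x z -> gdist e x z = 2.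
Proof.
move=> irr_e exy eyz neq_xz nexz; have xzp := uv_path2 irr_e exy eyz neq_xz.
apply/eqP; rewrite eqn_leq (gdist_le xzp) /=.
have [[|a [|b q]]] := geodesic_exists xzp;
  rewrite /geodesic /uv_path /= => /andP[+ /eqP <-] //.
- by move/eqP=> def_z; rewrite def_z eqxx in neq_xz.
- rewrite andbT => /and3P[exa _ /eqP def_z].
  by rewrite def_z (negPf nexz) in exa.
Qed.

(** The hypothesis [diam2] says that the diameter is at most 2: geodesics then
    have at most three vertices, and those with three are the induced paths on
    three vertices. *)
Lemma general_positionP (R : {set T}) :
    irreflexive e ->
    (forall x y, x != y -> e x y || [exists m, e x m && e m y]) ->
  reflect {in R & &, forall x y z, e x y -> e y z -> x != z -> e x z}
          (general_position e R).
Proof.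
move=> irr_e diam2; have neq_e a b : e a b -> a != b.
  by apply: contraTneq => ->; rewrite irr_e.
apply: (iffP idP) => [gpR x y z Rx Ry Rz exy eyz neq_xz | trR].
  apply/negPn/negP => nexz.
  have /forall_inP/(_ y Ry)/forall_inP/(_ z Rz) := forall_inP gpR x Rx.
  rewrite /= !inE negb_or (neq_e _ _ exy) neq_xz (neq_e _ _ eyz) /=.
  move/negP; apply.
  have d2 := gdist_induced_path3 irr_e exy eyz neq_xz nexz.
  apply/existsP; exists x; apply/existsP; exists z.
  rewrite /geodesic d2; apply/existsP; exists [tuple y; z].
  by rewrite uv_path2 //= !inE !eqxx !orbT.
apply/forall_inP => x Rx; apply/forall_inP => y Ry; apply/forall_inP => z Rz.
apply/implyP => Uxyz; apply/negP => /existsP[u /existsP[v /existsP[p]]].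
case/and3P=> /andP[uvp /eqP size_p] xp /andP[yp zp].
have sub_p : {subset [:: x; y; z] <= u :: p}.
  by move=> w; rewrite !inE => /or3P[] /eqP ->.
have ge_p : 2 <= size p by apply: (uniq_leq_size Uxyz sub_p).
have neq_uv : u != v.
  apply/negP => /eqP def_v.
  have /gdist_le : uv_path e u v [::] by rewrite /uv_path /= def_v eqxx.
  by rewrite -size_p leqNgt (leq_trans _ ge_p).
have neuv : ~~ e u v.
  apply/negP => euv.
  have /gdist_le : uv_path e u v [:: v].
    by rewrite /uv_path /= euv inE neq_uv eqxx.
  by rewrite -size_p leqNgt ge_p.
have le_p : size p <= 2.
  have := diam2 u v neq_uv; rewrite (negPf neuv) => /existsP[m /andP[eum emv]].
  by rewrite size_p (gdist_induced_path3 irr_e eum emv neq_uv neuv).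
(* The three vertices fill the geodesic, whose vertices are hence all in R. *)
have [_ mem_p] := uniq_min_size Uxyz sub_p le_p.
have Rp w : w \in u :: p -> w \in R.
  by rewrite -mem_p !inE => /or3P[] /eqP ->.
move: uvp le_p ge_p Rp; case: {size_p xp yp zp sub_p mem_p} (val p).
  by [].
move=> a [|b [|//]] //; rewrite /uv_path /= andbT.
case/and3P=> /andP[eua eab] _ /eqP def_v _ _ Rp; rewrite def_v in eab Rp.
by rewrite (trR u a v) ?Rp ?inE ?eqxx ?orbT // in neuv.
Qed.

Lemma gpE (m : nat) (R : {set T}) :
    general_position e R -> #|R| = m ->
    (forall A : {set T}, general_position e A -> #|A| <= m) ->
  gp e = m.
Proof.
move=> gpR <- max_R; apply/eqP; rewrite eqn_leq; apply/andP; split.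
  by apply/bigmax_leqP => A /max_R.
exact: (bigmax_sup R).
Qed.

End Geodesics.

(** * Cones *)

Lemma general_position_coneP (T : finType) (e : rel T) (R : {set option T}) :
    irreflexive e ->
  reflect {in R & &, forall x y z,
             cone e x y -> cone e y z -> x != z -> cone e x z}
          (general_position (cone e) R).
Proof.
move=> irr_e; apply: general_positionP => [[x|] | x y] //=.
case: x y => [x|] [y|] //= _; apply/orP; right; apply/existsP.
by exists None.
Qed.

Lemma card_option_set (T : finType) (R : {set option T}) :
  #|R| = (None \in R) + #|[set i | Some i \in R]|.
Proof.
rewrite (cardsD1 None); congr (_ + _).
rewrite -(card_imset _ (@Some_inj _ : injective (@Some T))); apply: eq_card => -[i|].
  by rewrite mem_imset ?inE //; apply: Some_inj.
by rewrite !inE /=; apply/esym/negbTE/imsetP => -[].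
Qed.

(** * Cycles *)

Lemma ord_eqE n (i j : 'I_n) : (i == j) = (i == j :> nat).
Proof. by []. Qed.

Lemma ordSE n (i : 'I_n) : ordS i = (if i.+1 == n then 0 else i.+1) :> nat.
Proof.
have := ltn_ord i; rewrite /= leq_eqVlt => /orP[/eqP def_n|lt_in].
  by rewrite def_n eqxx modnn.
by rewrite (ltn_eqF lt_in) modn_small.
Qed.

(** Adjacency in the cycle, freed of the modulus so that linear arithmetic can
    reason about it. *)
Lemma cycle_graphE n (i j : 'I_n) :
  cycle_graph n i j =
    [|| j == i.+1 :> nat, i == j.+1 :> nat,
        (j == 0 :> nat) && (i.+1 == n) | (i == 0 :> nat) && (j.+1 == n)].
Proof.
rewrite /cycle_graph !ord_eqE !ordSE.
by have := ltn_ord i; have := ltn_ord j; do 2!case: ifP; lia.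
Qed.

Lemma cycle_irr n : 1 < n -> irreflexive (cycle_graph n).
Proof. by move=> n_gt1 i; have := wheel_irrefl n_gt1 (Some i). Qed.

Lemma card_cycle_clique n (A : {set 'I_n}) :
    3 < n -> {in A &, forall i j, i != j -> cycle_graph n i j} -> #|A| <= 2.
Proof.
move=> n_gt3 clA; rewrite leqNgt; apply/negP => /card_gt2P[i [j [k]]].
case=> -[Ai Aj Ak] [neq_ij neq_jk neq_ki].
move: (clA _ _ Ai Aj neq_ij) (clA _ _ Aj Ak neq_jk) (clA _ _ Ak Ai neq_ki).
rewrite !cycle_graphE; move: neq_ij neq_jk neq_ki; rewrite !ord_eqE.
have := ltn_ord i; have := ltn_ord j; have := ltn_ord k; lia.
Qed.

(** Double counting of the pairs formed by a window of three consecutive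
    vertices and an element of the set in that window. *)
Lemma card_no_three_consecutive n (A : {set 'I_n}) :
    (forall i, ~~ [&& i \in A, ordS i \in A & ordS (ordS i) \in A]) ->
  3 * #|A| <= 2 * n.
Proof.
move=> no3; have shift (F : 'I_n -> nat) : \sum_i F (ordS i) = \sum_i F i.
  by rewrite [RHS](reindex (@ordS n)) //; apply: onW_bij; apply: ordS_bij.
have cardA : #|A| = \sum_i (i \in A) by rewrite -sum1_card big_mkcond.
have <- : \sum_i ((i \in A) + (ordS i \in A) + (ordS (ordS i) \in A)) = 3 * #|A|.
  rewrite !big_split /= (shift (fun i => ordS i \in A : nat)).
  by rewrite (shift (fun i => i \in A : nat)) -cardA !mulSn addn0 addnA.
have -> : 2 * n = \sum_(i < n) 2 by rewrite sum_nat_const card_ord mulnC.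
by apply: leq_sum => i _; move: (no3 i); do 3!case: (_ \in A).
Qed.

Lemma card_not_multiple3 n : #|[set i : 'I_n | ~~ (3 %| i)]| = (2 * n) %/ 3.
Proof.
rewrite -sum1_card big_mkcond /=; under eq_bigr do rewrite inE.
elim: n => [|n IHn]; first by rewrite big_ord0.
by rewrite big_ord_recr /= IHn; case: ifP; lia.
Qed.

(** * Wheels *)

Lemma wheel_general_positionP n (R : {set option 'I_n}) :
    1 < n ->
  reflect {in R & &, forall x y z,
             wheel n x y -> wheel n y z -> x != z -> wheel n x z}
          (general_position (wheel n) R).
Proof. by move=> n_gt1; apply/general_position_coneP/cycle_irr. Qed.

Lemma card_wheel_general_position n (R : {set option 'I_n}) :
  3 < n -> general_position (wheel n) R -> #|R| <= maxn 3 ((2 * n) %/ 3).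
Proof.
move=> n_gt3 /(wheel_general_positionP _ (ltnW (ltnW n_gt3))) trR.
rewrite card_option_set leq_max; set A := [set i | _].
have [RN | _] := boolP (None \in R); apply/orP; [left | right].
  apply: (card_cycle_clique n_gt3) => i j; rewrite !inE => Ri Rj neq_ij.
  exact: (trR (Some i) None (Some j)).
rewrite leq_divRL // mulnC; apply: card_no_three_consecutive => i.
rewrite !inE; apply/negP => /and3P[R0 R1 R2].
have adjS k : cycle_graph n k (ordS k) by rewrite /cycle_graph eqxx.
(* On a cycle of at least four vertices, i and i + 2 are distinct and not
   adjacent. *)
have neq02 : Some i != Some (ordS (ordS i)).
  rewrite (inj_eq Some_inj) ord_eqE !ordSE.
  by have := ltn_ord i; do 2!case: ifP; lia.
have /= := trR _ _ _ R0 R1 R2 (adjS _) (adjS _) neq02.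
rewrite /wheel /= cycle_graphE !ordSE.
by have := ltn_ord i; do 2!case: ifP; lia.
Qed.

Lemma wheel_clique3 n : 2 < n ->
  exists2 R : {set option 'I_n}, general_position (wheel n) R & #|R| = 3.
Proof.
case: n => [|[|[|n]]] // _; pose o1 : 'I_n.+3 := inord 1.
have v1 : o1 = 1 :> nat by rewrite inordK.
exists [set None; Some ord0; Some o1].
  apply/wheel_general_positionP => // x y z.
  rewrite !inE -!orbA => /or3P[] /eqP -> /or3P[] /eqP -> /or3P[] /eqP -> //;
  by rewrite /wheel /= !cycle_graphE v1 ?eqxx.
rewrite card_option_set !inE /=; congr (1 + _).
rewrite (_ : [set i | _] = [set ord0; o1]); last by apply/setP => i; rewrite !inE.
by rewrite cards2 ord_eqE v1.
Qed.

Lemma wheel_rim_example n : 2 < n ->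
  exists2 R : {set option 'I_n},
    general_position (wheel n) R & #|R| = (2 * n) %/ 3.
Proof.
move=> n_gt2; exists (Some @: [set i : 'I_n | ~~ (3 %| i)]).
  apply/wheel_general_positionP => [|x y z]; first exact: ltnW.
  case/imsetP=> i + -> /imsetP[j + ->] /imsetP[k + ->]; rewrite !inE.
  rewrite /wheel /= !cycle_graphE (inj_eq Some_inj) ord_eqE => Ri Rj Rk.
  by have := ltn_ord i; have := ltn_ord j; have := ltn_ord k; lia.
by rewrite card_imset ?card_not_multiple3 //; apply: Some_inj.
Qed.

Theorem theorem4p1 (n : nat) (n_ge3 : 3 <= n) :
  gp (wheel n) =
    if n == 3 then 4
    else if (n == 4) || (n == 5) then 3
    else (2 * n) %/ 3.
Proof.
have [->|neq_n3] := eqVneq n 3.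
  apply: (gpE (R := setT)) => [||A _].
  - apply/wheel_general_positionP => // x y z _ _ _ _ _.
    case: x z => [x|] [z|] //; rewrite /wheel /= cycle_graphE.
    rewrite (inj_eq Some_inj) ord_eqE.
    by have := ltn_ord x; have := ltn_ord z; lia.
  - by rewrite cardsT card_option card_ord.
  - by rewrite (leq_trans (max_card _)) // card_option card_ord.
have n_gt3 : 3 < n by rewrite ltn_neqAle eq_sym neq_n3.
case: ifP => n45.
  have [R gpR cardR] := wheel_clique3 n_ge3.
  apply: (gpE gpR cardR) => A /(card_wheel_general_position n_gt3) leA.
  by apply: leq_trans leA _; case/orP: n45 => /eqP ->.
have [R gpR cardR] := wheel_rim_example n_ge3.
apply: (gpE gpR cardR) => A /(card_wheel_general_position n_gt3) leA.
by apply: leq_trans leA _; lia.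
Qed.
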